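(* Let $N\ge 3$ be an integer and let $X$ be a smooth hypersurface of degree $d\ge 3$ in $\mathbb{P}^N$. Let $L$ be a line in $\mathbb{P}^N$ with $L\not\subset X$ and assume $P_1,\ldots,P_{d-1}$ are $d-1$ different star points of $X$ on $L$. Then $L$ intersects $X$ transversally at $d$ points $P_1,\ldots,P_d$, and $P_d$ is also a star point of $X$.
   Context: The base field is $\mathbb{C}$. For a smooth point $P$ of a hypersurface $X\subset\mathbb{P}^N$ of degree $d$, $T_P(X)$ denotes the embedded tangent hyperplane of $X$ at $P$; $P$ is a star point of $X$ if the scheme $T_P(X)\cap X$ has multiplicity $d$ at $P$ (equivalently, for $N\ge3$, it is a cone of degree $d$ with vertex $P$ in $T_P(X)$). *)

(* Defs.v *)
From mathcomp Require Import all_boot all_order all_algebra.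
From mathcomp Require Import reals complex.
From mathcomp Require Import mpoly.

Set Implicit Arguments.
Unset Strict Implicit.
Unset Printing Implicit Defensive.

Import GRing.Theory.
Local Open Scope ring_scope.

(* P^(n-1) over C: a point is represented by a nonzero row vector, up to
   scaling, and a linear subspace by any matrix whose row space is the
   corresponding vector subspace of C^n; incidence and equality are therefore
   the row space relations of mxalgebra.
   A hypersurface of degree d is represented by a defining form F. *)

Definition is_point (C : fieldType) (n : nat) (P : 'rV[C]_n) : Prop := P != 0.

Definition distinct_points (C : fieldType) (n : nat) (I : eqType)
    (P : I -> 'rV[C]_n) : Prop :=
  forall i j : I, i != j -> ~~ (P i == P j)%MS.

Definition is_line (C : fieldType) (n : nat) (L : 'M[C]_(2, n)) : Prop :=
  \rank L = 2%N.

Definition is_hypersurface (C : fieldType) (n d : nat) (F : {mpoly C[n]}) :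
    Prop :=
  F != 0 /\ F \is d.-homog.

Definition on_hyp (C : fieldType) (n : nat) (F : {mpoly C[n]})
    (P : 'rV[C]_n) : Prop :=
  F.@[P 0] = 0.

Definition sub_hyp (C : fieldType) (n m : nat) (F : {mpoly C[n]})
    (L : 'M[C]_(m, n)) : Prop :=
  forall Q : 'rV[C]_n, is_point Q -> (Q <= L)%MS -> on_hyp F Q.

Definition gradient (C : fieldType) (n : nat) (F : {mpoly C[n]})
    (P : 'rV[C]_n) : 'rV[C]_n :=
  \row_(i < n) (mderiv i F).@[P 0].

Definition smooth_at (C : fieldType) (n : nat) (F : {mpoly C[n]})
    (P : 'rV[C]_n) : Prop :=
  gradient F P != 0.

Definition smooth_hyp (C : fieldType) (n : nat) (F : {mpoly C[n]}) : Prop :=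
  forall P : 'rV[C]_n, is_point P -> on_hyp F P -> smooth_at F P.

(* The embedded tangent hyperplane at P, { v | \sum_i (dF/dX_i)(P) v_i = 0 }
   (a hyperplane only if P is a smooth point). *)
Definition tangent_hyperplane (C : fieldType) (n : nat) (F : {mpoly C[n]})
    (P : 'rV[C]_n) : 'M[C]_n :=
  kermx (gradient F P)^T.

(* The polynomial F(P + y_1 B_1 + ... + y_k B_k), where B_j are the rows of B.
   If P, B_1, ..., B_k is a basis of a linear subspace T, this is the equation
   of T \cap {F = 0} in the affine chart of T centered at P with coordinates
   y_1, ..., y_k. *)
Definition local_equation (C : fieldType) (n k : nat) (F : {mpoly C[n]})
    (P : 'rV[C]_n) (B : 'M[C]_(k, n)) : {mpoly C[k]} :=
  F \mPo [tuple (P 0 i)%:MP + \sum_(j < k) B j i *: 'X_j | i < n].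

(* m is the least degree of a monomial of f, i.e., f lies in the m-th power of
   the maximal ideal at the origin but not in the (m+1)-st. *)
Definition order_at_origin (C : fieldType) (k : nat) (f : {mpoly C[k]})
    (m : nat) : Prop :=
  (forall u : 'X_{1..k}, (mdeg u < m)%N -> f@_u = 0) /\
  (exists u : 'X_{1..k}, mdeg u = m /\ f@_u != 0).

(* The scheme T \cap {F = 0} has multiplicity m at the point P of T; m does
   not depend on the choice of the basis. There is no such m if T is contained
   in {F = 0}. *)
Definition has_multiplicity (C : fieldType) (n t : nat) (F : {mpoly C[n]})
    (T : 'M[C]_(t, n)) (P : 'rV[C]_n) (m : nat) : Prop :=
  exists (k : nat) (B : 'M[C]_(k, n)),
    [/\ row_free (col_mx P B), (col_mx P B == T)%MS
      & order_at_origin (local_equation F P B) m].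

Definition star_point (C : fieldType) (n d : nat) (F : {mpoly C[n]})
    (P : 'rV[C]_n) : Prop :=
  [/\ is_point P, on_hyp F P, smooth_at F P
    & has_multiplicity F (tangent_hyperplane F P) P d].

Definition transversal_at (C : fieldType) (n m : nat) (F : {mpoly C[n]})
    (L : 'M[C]_(m, n)) (P : 'rV[C]_n) : Prop :=
  smooth_at F P /\ ~~ (L <= tangent_hyperplane F P)%MS.

(* L meets {F = 0} exactly at the d distinct points Q i, transversally at each
   of them. *)
Definition meets_transversally_at (C : fieldType) (n m d : nat)
    (F : {mpoly C[n]}) (L : 'M[C]_(m, n)) (Q : 'I_d -> 'rV[C]_n) : Prop :=
  [/\ forall i : 'I_d, is_point (Q i) /\ (Q i <= L)%MS,
      distinct_points Q,
      forall P : 'rV[C]_n, is_point P -> (P <= L)%MS ->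
        (on_hyp F P <-> exists i : 'I_d, (P == Q i)%MS)
    & forall i : 'I_d, transversal_at F L (Q i)].

(* Main.v *)
Require Import Defs.
From mathcomp Require Import all_boot all_order all_algebra.
From mathcomp Require Import reals complex.
From mathcomp Require Import mpoly.
From mathcomp Require Import ring.
From mathcomp Require boolp.

Set Implicit Arguments.
Unset Strict Implicit.
Unset Printing Implicit Defensive.

Import Order.TTheory GRing.Theory Num.Theory.
Local Open Scope ring_scope.

(** Write d = k + 1 and let l_i be the differential of F at P_i, so that the
    tangent hyperplane T_i is l_i = 0.  By homogeneity, P_i is a star point
    exactly when F, restricted to the vector subspace T_i, is nonzero and
    invariant under translation by P_i ([star_pointP]).

    Choose u on L with F(u) <> 0.  Since there are at least two star points on
    L and L is not contained in X, no T_i contains L ([tangent_form_u_neq0]);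
    hence T_i meets L only in P_i, and l_i can be normalized to a linear form
    tau_i with tau_i(u) = 1.

    The restriction of F to T_i descends to T_i / P_i, which is the quotient
    V / L of the ambient vector space.  The forms on V / L obtained from T_i
    and T_j agree, because T_i \cap T_j maps isomorphically onto V / L
    ([eq_value_tangents]).  So there is a single form F0 on V / L
    ([quotient_form]) such that F - F0 vanishes on every T_i.  Comparing
    degrees gives the normal form ([normal_form])

      F = F0 + mu * tau_1 * ... * tau_k,    mu a linear form.

    Instead of dividing multivariate polynomials, one expands F(v + t u) - F0(v)
    as a polynomial of degree k + 1 in t: it has the k roots - tau_i(v), and
    the remaining root, given by the sum of the roots, is visibly linear in v.

    Everything is read off the normal form.  On L it says that F is the product
    of mu and the tau_i, so the last point P_d is the zero of mu on L.  It
    differs from the P_i, as otherwise F would have a double zero at some P_i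
    on L ([mu_P_neq0]).  The differential of F at P_d is a nonzero multiple of
    mu ([gradient_last_point]), so L is transversal to X there, and on its
    tangent hyperplane mu = 0 the form F equals F0, which is invariant under
    translation by the vector P_d of L ([cone_last_point]). *)

(** * Univariate polynomials over a field of characteristic zero *)

Section UnivariatePolynomials.

Context {C : numFieldType}.
Implicit Types p q b : {poly C}.

Lemma poly_neq0_nonroot p : p != 0 -> exists s, p.[s] != 0.
Proof.
move=> p0.
have [/hasP[s _ ps]|/hasPn ps] :=
    boolP (has (fun s => p.[s] != 0) [seq i%:R | i <- iota 0 (size p)]).
  by exists s.
case/eqP: p0; apply: roots_geq_poly_eq0.
- by apply/allP => s /ps; rewrite negbK.
- by rewrite map_inj_uniq ?iota_uniq // => i j /eqP; rewrite eqr_nat => /eqP.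
- by rewrite size_map size_iota.
Qed.

(** Identities between polynomials are proved pointwise; the factor b lets a
    degenerate locus be left out. *)
Lemma poly_eq_off_roots b p q :
  b != 0 -> (forall s, b.[s] != 0 -> p.[s] = q.[s]) -> p = q.
Proof.
move=> b0 pq; apply/eqP; rewrite -subr_eq0; apply: contraT => pq0.
have [s] := poly_neq0_nonroot (mulf_neq0 b0 pq0).
rewrite hornerM hornerD hornerN mulf_eq0 negb_or => /andP[/pq ->].
by rewrite subrr eqxx.
Qed.

Lemma poly_eq_horner p q : (forall s, p.[s] = q.[s]) -> p = q.
Proof.
by move=> pq; apply: (@poly_eq_off_roots 1) => [|s _]; rewrite ?oner_neq0.
Qed.

Lemma poly_eq_off0 p q : (forall s, s != 0 -> p.[s] = q.[s]) -> p = q.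
Proof.
move=> pq; apply: (@poly_eq_off_roots 'X) => [|s]; first by rewrite polyX_eq0.
by rewrite hornerX; exact: pq.
Qed.

(** When all roots of a polynomial but one are known, the last one is determined
    by the two top coefficients, through the sum of the roots. *)
Lemma split_off_roots k p (r : 'I_k -> C) :
    (0 < k)%N -> (size p <= k.+2)%N -> injective r ->
    (forall i, p.[r i] = 0) ->
  p = (p`_k.+1 *: 'X + (p`_k + p`_k.+1 * \sum_i r i)%:P)
      * \prod_i ('X - (r i)%:P).
Proof.
move=> k0 sp rI rp.
pose rs := [seq r i | i <- enum 'I_k].
have srs : size rs = k by rewrite size_map size_enum_ord.
have Ers : \prod_(z <- rs) ('X - z%:P) = \prod_i ('X - (r i)%:P).
  by rewrite big_map big_enum.
have Esum : \sum_(z <- rs) z = \sum_i r i by rewrite big_map big_enum.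
have [||q Eq] := @uniq_roots_prod_XsubC _ p rs.
- by apply/allP => z /mapP[i _ ->]; apply/eqP/rp.
- by rewrite uniq_rootsE map_inj_uniq ?enum_uniq.
have sq : (size q <= 2)%N.
  have [->|q0] := eqVneq q 0; first by rewrite size_poly0.
  move: sp; rewrite Eq size_Mmonic ?monic_prod_XsubC //.
  by rewrite size_prod_XsubC srs addnS /= -[k.+2]/(2 + k)%N leq_add2r.
have Eq2 : q = q`_1 *: 'X + (q`_0)%:P.
  apply/polyP => -[|[|i]]; rewrite !coefE ?mulr1 ?mulr0 ?add0r ?addr0 //=.
  by rewrite nth_default // (leq_trans sq).
have Pk : (\prod_(z <- rs) ('X - z%:P))`_k = 1.
  have /monicP := monic_prod_XsubC rs xpredT id.
  by rewrite lead_coefE size_prod_XsubC srs.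
have Pk1 : (\prod_(z <- rs) ('X - z%:P))`_k.-1 = - \sum_i r i.
  by have := @coefPn_prod_XsubC _ rs; rewrite srs -lt0n k0 Esum => ->.
have PkS : (\prod_(z <- rs) ('X - z%:P))`_k.+1 = 0.
  by rewrite nth_default // size_prod_XsubC srs.
have E1 : p`_k.+1 = q`_1.
  by rewrite Eq Eq2 mulrDl coefD -scalerAl coefZ coefXM coefCM PkS Pk
             !coefE /= ?mulr1 ?mulr0 !addr0.
have E0 : p`_k = q`_0 - q`_1 * \sum_i r i.
  rewrite Eq Eq2 mulrDl coefD -scalerAl coefZ coefXM coefCM Pk.
  rewrite (gtn_eqF k0) Pk1 !coefE /= ?mulr1 ?mulr0 !add0r !addr0.
  by rewrite mulrN addrC.
by rewrite E1 E0 subrK -Eq2 -Ers.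
Qed.

End UnivariatePolynomials.

(** * Restriction of a polynomial to a parametrized line *)

Section Pencil.

Context {C : numFieldType} {n : nat}.
Implicit Types (F : {mpoly C[n]}) (x w g : 'rV[C]_n).

Lemma mnm_neq0_split (m : 'X_{1..n}) :
  m != 0%MM -> exists i m', m = (U_(i) + m')%MM /\ mdeg m = (mdeg m').+1.
Proof.
move=> m0; have [i mi] : exists i, m i != 0%N.
  apply/existsP; apply: contraNT m0; rewrite negb_exists => /forallP H.
  by apply/eqP/mnmP => i; rewrite mnm0E; move: (H i); rewrite negbK => /eqP.
have Em : m = (U_(i) + (m - U_(i)))%MM.
  apply/mnmP => j; rewrite mnmDE mnmBE mnm1E.
  by case: eqP => [<-|_] /=; rewrite ?subnKC ?lt0n // add0n subn0.
by exists i, (m - U_(i))%MM; split=> //; rewrite {1}Em mdegD mdeg1.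
Qed.

(** Linear forms are represented by row vectors, as gradients are. *)
Definition pairing g x : C := (x *m g^T) 0 0.

Lemma pairingE g x : pairing g x = \sum_i x 0 i * g 0 i.
Proof. by rewrite /pairing mxE; apply: eq_bigr => i _; rewrite mxE. Qed.

Lemma pairingDr g x w : pairing g (x + w) = pairing g x + pairing g w.
Proof. by rewrite /pairing mulmxDl mxE. Qed.

Lemma pairingZr g a x : pairing g (a *: x) = a * pairing g x.
Proof. by rewrite /pairing -scalemxAl mxE. Qed.

Lemma pairingBr g x w : pairing g (x - w) = pairing g x - pairing g w.
Proof. by rewrite -scaleN1r pairingDr pairingZr mulN1r. Qed.

Lemma pairingZl g a x : pairing (a *: g) x = a * pairing g x.
Proof. by rewrite /pairing linearZ /= -scalemxAr mxE. Qed.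

Lemma pairingDl g h x : pairing (g + h) x = pairing g x + pairing h x.
Proof. by rewrite /pairing linearD /= mulmxDr mxE. Qed.

Lemma pairingBl g h x : pairing (g - h) x = pairing g x - pairing h x.
Proof. by rewrite -scaleN1r pairingDl pairingZl mulN1r. Qed.

Lemma pairing_suml k (g : 'I_k -> 'rV[C]_n) x :
  pairing (\sum_i g i) x = \sum_i pairing (g i) x.
Proof. by rewrite /pairing linear_sum mulmx_sumr summxE. Qed.

Lemma pairing0r g : pairing g 0 = 0.
Proof. by rewrite /pairing mul0mx mxE. Qed.

Lemma pairing0l x : pairing 0 x = 0.
Proof. by rewrite /pairing trmx0 mulmx0 mxE. Qed.

Lemma tangent_hyperplaneP F x w :
  (w <= tangent_hyperplane F x)%MS = (pairing (gradient F x) w == 0).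
Proof.
rewrite /tangent_hyperplane /pairing; apply/sub_kermxP/eqP => [->|E].
  by rewrite mxE.
by apply/matrixP => i j; rewrite !ord1 E mxE.
Qed.

Definition pencil F x w : {poly C} :=
  mmap (@polyC C) (fun i => (x 0 i)%:P + (w 0 i) *: 'X) F.

Lemma horner_pencil F x w s : (pencil F x w).[s] = F.@[(x + s *: w) 0].
Proof.
rewrite /pencil /mmap horner_sum mevalE; apply: eq_bigr => m _.
rewrite hornerM hornerC; congr (_ * _); rewrite /mmap1 horner_prod.
by apply: eq_bigr => i _; rewrite horner_exp !hornerE !mxE [s * _]mulrC.
Qed.

Lemma coef0_pencil F x w : (pencil F x w)`_0 = F.@[x 0].
Proof. by rewrite -horner_coef0 horner_pencil scale0r addr0. Qed.

(** The chain rule, proved on monomials by splitting off one variable at a time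
    and using Leibniz' rule on both sides. *)
Lemma deriv_pencil F x w :
  (pencil F x w)^`() = \sum_i w 0 i *: pencil (mderiv i F) x w.
Proof.
elim/mpolyind: F => [|c m F _ _ IH].
  rewrite /pencil mmap0 deriv0 big1 // => i _.
  by rewrite mderiv0 mmap0 scaler0.
rewrite /pencil mmapD derivD -/(pencil F x w) IH.
under [in RHS]eq_bigr do rewrite mderivD mmapD scalerDr.
rewrite big_split /=; congr (_ + _).
rewrite mmapZ /= mul_polyC derivZ.
under eq_bigr do rewrite mderivZ mmapZ /= mul_polyC scalerA mulrC -scalerA.
rewrite -scaler_sumr; congr (_ *: _).
have [k] := ubnP (mdeg m); elim: k m => // k IHk m; rewrite ltnS => mk.
have [->|m0] := eqVneq m 0%MM.
  rewrite mpolyX0 rmorph1 derivC big1 // => i _.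
  by rewrite -mpolyC1 mderivC mmap0 scaler0.
have [i [m' [Em dm]]] := mnm_neq0_split m0; rewrite dm in mk.
rewrite Em mpolyXD rmorphM /= derivM (IHk _ mk).
under [in RHS]eq_bigr do rewrite mderivM rmorphD !rmorphM /= scalerDr.
rewrite big_split /=; congr (_ + _); last first.
  by rewrite mulr_sumr; apply: eq_bigr => j _; rewrite scalerAr.
rewrite mmapX mmap1U derivD derivC derivZ derivX add0r.
rewrite (bigD1 i) //= big1 => [|j ji].
  rewrite addr0 mderivX mnm1E eqxx scale1r -{1}[U_(i)%MM]addm0 addmC addmK.
  rewrite mpolyX0 rmorph1 mul1r.
  by rewrite -scalerAl mul1r.
by rewrite mderivX mnm1E eq_sym (negbTE ji) scale0r mmap0 mul0r scaler0.
Qed.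

Lemma coef1_pencil F x w : (pencil F x w)`_1 = pairing (gradient F x) w.
Proof.
have -> : (pencil F x w)`_1 = (pencil F x w)^`()`_0 by rewrite coef_deriv.
rewrite deriv_pencil coef_sum pairingE; apply: eq_bigr => i _.
by rewrite coefZ coef0_pencil mxE.
Qed.

Lemma meval_origin F : F.@[(0 : 'rV[C]_n) 0] = F@_0%MM.
Proof.
elim/mpolyind: F => [|c m F _ _ IH]; first by rewrite meval0 mcoeff0.
rewrite mevalD mevalZ mevalX mcoeffD mcoeffZ mcoeffX IH; congr (_ * _ + _).
have [->|m0] := eqVneq m 0%MM.
  by rewrite big1 // => i _; rewrite mnm0E.
have [i [m' [-> _]]] := mnm_neq0_split m0.
by rewrite (bigD1 i) //= mxE expr0n mnmDE mnm1E eqxx mul0r.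
Qed.

(** A polynomial that vanishes everywhere has partial derivatives that vanish
    everywhere, so induction on the degree of a monomial shows that its
    coefficient is zero; characteristic zero is used to divide by the exponent
    produced by the derivation. *)
Lemma mpoly_eq0_meval F : (forall x : 'rV[C]_n, F.@[x 0] = 0) -> F = 0.
Proof.
move=> F0; apply/mpolyP => m; rewrite mcoeff0.
have [k] := ubnP (mdeg m); elim: k m F F0 => // k IHk m F F0; rewrite ltnS => mk.
have [->|m0] := eqVneq m 0%MM; first by rewrite -meval_origin.
have [i [m' [Em dm]]] := mnm_neq0_split m0; rewrite dm in mk.
have dF0 (x : 'rV[C]_n) : (mderiv i F).@[x 0] = 0.
  have p0 : pencil F x (delta_mx 0 i) = 0.
    by apply: poly_eq_horner => s; rewrite horner_pencil F0 horner0.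
  have := coef1_pencil F x (delta_mx 0 i); rewrite p0 coef0 pairingE.
  rewrite (bigD1 i) //= big1 => [|j ji]; first by rewrite !mxE !eqxx mul1r addr0.
  by rewrite mxE (negbTE ji) andbF mul0r.
have /eqP := IHk _ _ dF0 mk; rewrite mcoeff_mderiv addmC -Em.
by rewrite mulrn_eq0 /= => /eqP.
Qed.

End Pencil.

(** * Homogeneous forms *)

Section HomogeneousForms.

Context {C : numFieldType} {n d : nat} {F : {mpoly C[n]}}.
Hypothesis homF : F \is d.-homog.
Implicit Types (x w : 'rV[C]_n).

Lemma meval_scale c x : F.@[(c *: x) 0] = c ^+ d * F.@[x 0].
Proof.
rewrite !mevalE mulr_sumr big_seq [RHS]big_seq; apply: eq_bigr => m mF.
under eq_bigr do rewrite mxE exprMn.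
rewrite big_split /= prodrXr -mdegE (dhomog_mf homF mF).
by rewrite mulrCA.
Qed.

Lemma meval_form0 : (0 < d)%N -> F.@[(0 : 'rV[C]_n) 0] = 0.
Proof.
by move=> d0; rewrite -(scale0r (0 : 'rV_n)) meval_scale expr0n gtn_eqF ?mul0r.
Qed.

Lemma size_pencil x w : (size (pencil F x w) <= d.+1)%N.
Proof.
rewrite /pencil /mmap big_seq; apply: (leq_trans (size_sum _ _ _)).
apply/bigmax_leqP_seq => m _ mF.
rewrite mul_polyC; apply: (leq_trans (size_scale_leq _ _)).
rewrite -(dhomog_mf homF mF) /= mdegE /mmap1.
apply: (big_rec2 (fun (q : {poly C}) e => (size q <= e.+1)%N)).
  by rewrite size_poly1.
move=> i e q _ sq; apply: (leq_trans (size_polyMleq _ _)).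
set l := (_ + _ *: 'X).
have sl : (size l <= 2)%N.
  apply: (leq_trans (size_polyD _ _)); rewrite geq_max size_polyC.
  rewrite (leq_trans (size_scale_leq _ _)) ?size_polyX //.
  by case: (_ != 0).
have sle : (size (l ^+ m i) <= (m i).+1)%N.
  apply: (leq_trans (size_poly_exp_leq _ _)); rewrite ltnS.
  by rewrite -[X in (_ <= X)%N]mul1n leq_mul2r orbC -subn1 leq_subLR sl.
rewrite -subn1 leq_subLR (leq_trans (leq_add sle sq)) //.
by rewrite addSn addnS.
Qed.

(** F(x + s w) = s^d F(w + s^-1 x): exchanging the roles of the two points
    reverses the coefficients.  This reads off the two top coefficients of
    F(x + s w) from the two bottom ones of F(w + s x). *)
Lemma coef_pencil_rev x w k :
  (k <= d)%N -> (pencil F x w)`_k = (pencil F w x)`_(d - k).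
Proof.
move=> kd; pose q := \poly_(j < d.+1) (pencil F w x)`_(d - j).
suff -> : pencil F x w = q by rewrite coef_poly ltnS kd.
apply: poly_eq_off0 => s s0.
have -> : (pencil F x w).[s] = s ^+ d * (pencil F w x).[s^-1].
  by rewrite !horner_pencil -meval_scale scalerDr scalerA divff // scale1r addrC.
rewrite (horner_coef_wide _ (size_pencil w x)) horner_poly mulr_sumr.
rewrite (reindex_inj rev_ord_inj) /=; apply: eq_bigr => j _.
rewrite subSS mulrCA exprVn -expfB_cond ?(negbTE s0) ?leq_subr //.
by rewrite subKn // -ltnS.
Qed.

Lemma coef_pencil_lead x w : (pencil F x w)`_d = F.@[w 0].
Proof. by rewrite coef_pencil_rev // subnn coef0_pencil. Qed.

Lemma coef_pencil_sublead x w :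
  (0 < d)%N -> (pencil F x w)`_d.-1 = pairing (gradient F w) x.
Proof.
move=> d0; rewrite coef_pencil_rev ?leq_pred // -coef1_pencil.
by rewrite -subn1 subKn.
Qed.

End HomogeneousForms.

(** * Star points and translation invariance *)

Section StarPoints.

Context {C : numFieldType} {n d : nat} (F : {mpoly C[n]}).
Hypothesis homF : F \is d.-homog.

Lemma meval_local_equation k (P : 'rV[C]_n) (B : 'M[C]_(k, n)) (y : 'rV[C]_k) :
  (local_equation F P B).@[y 0] = F.@[(P + y *m B) 0].
Proof.
rewrite /local_equation comp_mpoly_meval; apply: meval_eq => i.
rewrite tnth_mktuple mevalD mevalC !mxE; congr (_ + _).
rewrite raddf_sum; apply: eq_bigr => j _.
by rewrite /= mevalZ mevalXU mulrC.
Qed.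

(** As a polynomial in t, F(P + t (y B)) is divisible by t^d, by the vanishing of
    the terms of low order, and has degree at most d. *)
Lemma pencil_local_equation k (P : 'rV[C]_n) (B : 'M[C]_(k, n)) (y : 'rV[C]_k) :
    (forall u : 'X_{1..k}, (mdeg u < d)%N -> (local_equation F P B)@_u = 0) ->
  pencil F P (y *m B) = F.@[(y *m B) 0] *: 'X^d.
Proof.
set f := local_equation F P B => f_low.
pose g := \sum_(m <- msupp f)
            (f@_m * \prod_i y 0 i ^+ m i) *: 'X^(mdeg m - d) : {poly C}.
have Epg : pencil F P (y *m B) = 'X^d * g.
  apply: poly_eq_horner => t.
  rewrite horner_pencil scalemxAl -meval_local_equation -/f mevalE.
  rewrite hornerM hornerXn horner_sum mulr_sumr.
  rewrite big_seq [RHS]big_seq; apply: eq_bigr => m mf.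
  under eq_bigr do rewrite mxE exprMn.
  rewrite big_split /= prodrXr -mdegE hornerZ hornerXn.
  have dm : (d <= mdeg m)%N.
    rewrite leqNgt; apply: contraL mf => /f_low.
    by rewrite mcoeff_msupp => ->; rewrite eqxx.
  by rewrite [RHS]mulrCA -exprD subnKC // mulrCA mulrC -mulrA.
apply/polyP => i; rewrite coefZ coefXn.
case: (ltngtP i d) => [id|di|->]; rewrite ?mulr0 ?mulr1.
- by rewrite Epg coefXnM id.
- by rewrite nth_default // (leq_trans (size_pencil homF _ _)).
- exact: coef_pencil_lead.
Qed.

Lemma local_equation_order_invariant k (P : 'rV[C]_n) (B : 'M[C]_(k, n)) y s :
    order_at_origin (local_equation F P B) d ->
  F.@[(y *m B + s *: P) 0] = F.@[(y *m B) 0].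
Proof.
case=> f_low _; have [->|s0] := eqVneq s 0; first by rewrite scale0r addr0.
have -> : y *m B + s *: P = s *: (P + s^-1 *: (y *m B)).
  by rewrite scalerDr scalerA divff // scale1r addrC.
rewrite (meval_scale homF) -horner_pencil pencil_local_equation //.
by rewrite hornerZ hornerXn mulrCA -exprMn divff // expr1n mulr1.
Qed.

Lemma mpoly_neq0_nonroot k (f : {mpoly C[k]}) :
  f != 0 -> exists y : 'rV[C]_k, f.@[y 0] != 0.
Proof.
move=> f0; suff /boolp.existsNP[y /eqP fy] : ~ forall y : 'rV[C]_k, f.@[y 0] = 0.
  by exists y.
by move=> /mpoly_eq0_meval f00; rewrite f00 eqxx in f0.
Qed.

Lemma linear_substitution_homog k (B : 'M[C]_(k, n)) :
  F \mPo [tuple \sum_(j < k) B j i *: 'X_j | i < n] \is d.-homog.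
Proof.
rewrite comp_mpolyEX big_seq; apply: rpred_sum => m mF.
rewrite dhomogZ // -(dhomog_mf homF mF) /= mdegE comp_mpolyX.
apply: (big_rec2 (fun (q : {mpoly C[k]}) e => q \is e.-homog)).
  exact: dhomog1.
move=> i e q _ hq; apply: dhomogM => //.
rewrite -[X in X.-homog]mul1n; apply: dhomogMn; rewrite tnth_mktuple.
apply: rpred_sum => j _; by rewrite dhomogZ // dhomogX /= mdeg1.
Qed.

(** Under the invariance, F(P + y B) = F(y B) for all y, and the right-hand
    side is homogeneous of degree d in y. *)
Lemma order_local_equation k (P : 'rV[C]_n) (B : 'M[C]_(k, n)) :
    (forall y : 'rV_k, F.@[(y *m B + P) 0] = F.@[(y *m B) 0]) ->
    (exists y : 'rV_k, F.@[(y *m B) 0] != 0) ->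
  order_at_origin (local_equation F P B) d.
Proof.
move=> inv [y Fy].
have homf : local_equation F P B \is d.-homog.
  suff -> : local_equation F P B
          = F \mPo [tuple \sum_(j < k) B j i *: 'X_j | i < n].
    exact: linear_substitution_homog.
  apply/eqP; rewrite -subr_eq0; apply/eqP/mpoly_eq0_meval => z.
  rewrite mevalB meval_local_equation [P + _]addrC inv comp_mpoly_meval.
  apply/eqP; rewrite subr_eq0; apply/eqP/meval_eq => i.
  rewrite tnth_mktuple raddf_sum mxE; apply: eq_bigr => j _.
  by rewrite /= mevalZ mevalXU mulrC.
split=> [u|]; first by move=> ud; rewrite (dhomog_nemf_coeff homf) ?ltn_eqF.
have f0 : local_equation F P B != 0.
  apply: contraNneq Fy => f0.
  by rewrite -inv [_ + P]addrC -meval_local_equation f0 meval0.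
exists (mlead (local_equation F P B)); split; last by rewrite mleadc_eq0.
exact: (dhomog_mf homf (mlead_supp f0)).
Qed.

Lemma complete_basis (P : 'rV[C]_n) t (T : 'M[C]_(t, n)) :
    P != 0 -> (P <= T)%MS ->
  exists k (B : 'M[C]_(k, n)), row_free (col_mx P B) /\ (col_mx P B == T)%MS.
Proof.
move=> P0 PT; exists (\rank (T :\: P)%MS), (row_base (T :\: P)%MS).
have capE : (T :&: P :=: P)%MS by apply: capmx_idPr.
have ET : (col_mx P (row_base (T :\: P)%MS) :=: T)%MS.
  apply: (eqmx_trans (eqmx_sym (addsmxE _ _))).
  apply: eqmx_trans (addsmx_diff_cap_eq T P).
  apply: (eqmx_trans (adds_eqmx (eqmx_refl _) (eq_row_base _))).
  by rewrite addsmxC; apply: adds_eqmx => //; apply: eqmx_sym.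
split; last exact/eqmxP.
by rewrite /row_free ET -(mxrank_cap_compl T P) capE rank_rV P0.
Qed.

(** F restricted to the vector subspace v |-> dF_P(v) = 0 comes from a nonzero
    form on the quotient of that subspace by P: this expresses without a choice
    of basis that the tangent section is a cone of degree d with vertex P. *)
Definition cone_point (P : 'rV[C]_n) : Prop :=
  [/\ pairing (gradient F P) P = 0,
      forall v s, pairing (gradient F P) v = 0 ->
        F.@[(v + s *: P) 0] = F.@[v 0]
    & exists v, pairing (gradient F P) v = 0 /\ F.@[v 0] != 0].

Lemma star_pointP (P : 'rV[C]_n) :
  star_point d F P <->
  [/\ is_point P, on_hyp F P, smooth_at F P & cone_point P].
Proof.
split=> [[P0 FP sP [k [B [freePB PBT ordf]]]]|[P0 FP sP [gP inv [v [gv Fv]]]]].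
  have inT v : pairing (gradient F P) v = 0 ->
      exists (y : 'rV_k) a, v = y *m B + a *: P.
    move=> /eqP; rewrite -tangent_hyperplaneP -(eqmxP PBT).
    case/submxP=> D ->; rewrite -[D]hsubmxK mul_row_col addrC.
    exists (rsubmx D), (lsubmx D 0 0); congr (_ + _).
    by rewrite -mul_scalar_mx -mx11_scalar.
  have /andP[PT BT] : (P <= tangent_hyperplane F P)%MS
                      && (B <= tangent_hyperplane F P)%MS.
    by rewrite -col_mx_sub (eqmxP PBT).
  split=> //; split.
  - by apply/eqP; rewrite -tangent_hyperplaneP.
  - move=> v s /inT[y [a ->]].
    by rewrite -addrA -scalerDl !local_equation_order_invariant.
  - have f0 : local_equation F P B != 0.
      have [_ [u [_ fu]]] := ordf.
      by apply: contraNneq fu => ->; rewrite mcoeff0.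
    have [y] := mpoly_neq0_nonroot f0.
    rewrite meval_local_equation => Fy; exists (P + y *m B); split=> //.
    apply/eqP; rewrite -tangent_hyperplaneP addmx_sub //.
    exact: submx_trans (submxMl _ _) BT.
split=> //.
have PT : (P <= tangent_hyperplane F P)%MS by rewrite tangent_hyperplaneP gP.
have [k [B [freePB PBT]]] := complete_basis P0 PT.
exists k, B; split=> //.
have gB (y : 'rV_k) : pairing (gradient F P) (y *m B) = 0.
  apply/eqP; rewrite -tangent_hyperplaneP (submx_trans (submxMl _ _)) //.
  have : (col_mx P B <= tangent_hyperplane F P)%MS by rewrite (eqmxP PBT).
  by rewrite col_mx_sub => /andP[].
apply: order_local_equation => [y|].
  by have := inv _ 1 (gB y); rewrite scale1r.
have : (v <= col_mx P B)%MS by rewrite (eqmxP PBT) tangent_hyperplaneP gv.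
case/submxP=> D Ev; exists (rsubmx D).
rewrite -(inv _ (lsubmx D 0 0)) //.
move: Fv; rewrite Ev -[D in D *m _]hsubmxK mul_row_col addrC.
by rewrite {1}[lsubmx D]mx11_scalar mul_scalar_mx.
Qed.

End StarPoints.

(** * Points and linear forms on a line *)

Section Lines.

Context {C : numFieldType} {n : nat} {L : 'M[C]_(2, n)}.
Hypothesis rankL : \rank L = 2%N.
Implicit Types (x y v g : 'rV[C]_n).

Lemma proportional_points x y : x != 0 -> (x <= y)%MS -> (x == y)%MS.
Proof.
move=> x0 xy; have y0 : y != 0.
  by apply: contraNneq x0 => y0; move: xy; rewrite y0 => /submx0null ->.
by rewrite -(geq_leqif (mxrank_leqif_eq xy)) !rank_rV x0 y0.
Qed.

Lemma line_span x y v :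
    y != 0 -> ~~ (x <= y)%MS -> (x <= L)%MS -> (y <= L)%MS -> (v <= L)%MS ->
  exists a b, v = a *: x + b *: y.
Proof.
move=> y0 xy xL yL vL; have xyL : (col_mx x y <= L)%MS by rewrite col_mx_sub xL.
have ltr : (\rank y < \rank (col_mx x y))%N.
  have /andP[xs ys] : (x <= col_mx x y)%MS && (y <= col_mx x y)%MS.
    by rewrite -col_mx_sub.
  by apply: rank_ltmx; rewrite ltmxE ys col_mx_sub (negbTE xy).
have : (v <= col_mx x y)%MS.
  apply: submx_trans vL _; rewrite -(geq_leqif (mxrank_leqif_sup xyL)) rankL.
  by move: ltr; rewrite rank_rV y0.
case/submxP=> D ->; exists (lsubmx D 0 0), (rsubmx D 0 0).
by rewrite -[D in LHS]hsubmxK mul_row_col -!mul_scalar_mx -!mx11_scalar.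
Qed.

Lemma zero_on_line g u y x :
    pairing g u != 0 -> y != 0 -> pairing g y = 0 -> pairing g x = 0 ->
    (u <= L)%MS -> (y <= L)%MS -> (x <= L)%MS ->
  exists b, x = b *: y.
Proof.
move=> gu y0 gy gx uL yL xL.
have uy : ~~ (u <= y)%MS.
  by apply: contraNN gu => /sub_rVP[a ->]; rewrite pairingZr gy mulr0.
have [a [b Ex]] := line_span y0 uy uL yL xL.
exists b; move: gx; rewrite Ex pairingDr !pairingZr gy mulr0 addr0 => /eqP.
by rewrite mulf_eq0 (negbTE gu) orbF => /eqP->; rewrite scale0r add0r.
Qed.

End Lines.

(** * Star points on a common line *)

Section StarPointsOnLine.

Context {C : numFieldType} {n k : nat} {F : {mpoly C[n]}} {L : 'M[C]_(2, n)}.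
Context {P : 'I_k -> 'rV[C]_n}.
Hypothesis homF : F \is k.+1.-homog.
Hypothesis k_gt1 : (1 < k)%N.
Hypothesis rankL : \rank L = 2%N.
Hypothesis LX : ~ sub_hyp F L.
Hypothesis PL : forall i, (P i <= L)%MS.
Hypothesis P_neq0 : forall i, P i != 0.
Hypothesis FP : forall i, F.@[P i 0] = 0.
Hypothesis coneP : forall i, cone_point F (P i).
Hypothesis distP : forall i j, i != j -> ~~ (P i == P j)%MS.

Let i0 : 'I_k := Ordinal (ltnW k_gt1).
Let i1 : 'I_k := Ordinal k_gt1.

Lemma other_index (i : 'I_k) : exists j, j != i.
Proof. by have [->|] := eqVneq i i0; [exists i1 | exists i0; rewrite eq_sym]. Qed.

Lemma not_sub_points i j : i != j -> ~~ (P i <= P j)%MS.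
Proof.
by move=> ij; apply: contra (distP ij); apply: proportional_points.
Qed.

(** F(P_0 + s P_1) cannot vanish identically in s, since its vanishing would put
    all of L into the hypersurface; a value of s that is not a root gives an
    explicit point. *)
Lemma line_nonzero_value : exists u : 'rV[C]_n, (u <= L)%MS /\ F.@[u 0] != 0.
Proof.
have [p0|] := eqVneq (pencil F (P i0) (P i1)) 0.
  case: LX => Q Q0 QL; rewrite /on_hyp.
  have [a [b ->]] := line_span rankL (P_neq0 i1) (@not_sub_points i0 i1 isT)
    (PL i0) (PL i1) QL.
  have [->|a0] := eqVneq a 0.
    by rewrite scale0r add0r (meval_scale homF) FP mulr0.
  have -> : a *: P i0 + b *: P i1 = a *: (P i0 + (a^-1 * b) *: P i1).
    by rewrite scalerDr scalerA mulrA divff // mul1r.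
  by rewrite (meval_scale homF) -horner_pencil p0 horner0 mulr0.
case/poly_neq0_nonroot=> s; rewrite horner_pencil => Fs.
by exists (P i0 + s *: P i1); split=> //; rewrite addmx_sub // scalemx_sub.
Qed.

Section NormalForm.

Context {u : 'rV[C]_n}.
Hypothesis uL : (u <= L)%MS.
Hypothesis Fu : F.@[u 0] != 0.

(** If u were in T_i, then writing u = a P_j + b P_i with j <> i, the vector
    a P_j would lie in T_i too, and translation by P_i would give
    F(u) = F(a P_j) = 0. *)
Lemma tangent_form_u_neq0 i : pairing (gradient F (P i)) u != 0.
Proof.
have [gP inv _] := coneP i.
apply: contra_neq Fu => gu.
have [j ji] := other_index i.
have [a [b Eu]] := line_span rankL (P_neq0 i) (not_sub_points ji) (PL j) (PL i) uL.
rewrite Eu inv; first by rewrite (meval_scale homF) FP mulr0.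
by move: gu; rewrite Eu pairingDr [pairing _ (b *: _)]pairingZr gP mulr0 addr0.
Qed.

Definition tau_form (i : 'I_k) : 'rV[C]_n :=
  (pairing (gradient F (P i)) u)^-1 *: gradient F (P i).
Notation tau i v := (pairing (tau_form i) v).

Lemma tau_u i : tau i u = 1.
Proof. by rewrite pairingZl mulVf // tangent_form_u_neq0. Qed.

Lemma tau_eq0 i v : (tau i v == 0) = (pairing (gradient F (P i)) v == 0).
Proof. by rewrite pairingZl mulf_eq0 invr_eq0 (negbTE (tangent_form_u_neq0 i)). Qed.

Lemma tauP i : tau i (P i) = 0.
Proof. by have [gP _ _] := coneP i; apply/eqP; rewrite tau_eq0 gP. Qed.

Lemma tau_line_eq0 i x : (x <= L)%MS -> tau i x = 0 -> exists b, x = b *: P i.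
Proof.
move=> xL tx; apply: (zero_on_line rankL _ (P_neq0 i) (tauP i) tx uL (PL i) xL).
by rewrite tau_u oner_neq0.
Qed.

Lemma tau_shift i v s : tau i v = 0 -> F.@[(v + s *: P i) 0] = F.@[v 0].
Proof.
have [_ inv _] := coneP i.
by move=> /eqP; rewrite tau_eq0 => /eqP; apply: inv.
Qed.

(** T_i meets L in the line spanned by P_i, along which F is constant on T_i. *)
Lemma eq_value_same_tangent i v w :
  tau i v = 0 -> tau i w = 0 -> (v - w <= L)%MS -> F.@[v 0] = F.@[w 0].
Proof.
move=> tv tw vwL; have [|b Eb] := tau_line_eq0 vwL (i := i).
  by rewrite pairingBr tv tw subrr.
by rewrite -[v](subrK w) Eb addrC tau_shift.
Qed.

Lemma tau_neq0 i j : i != j -> tau i (P j) != 0.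
Proof.
move=> ij; apply: contraNneq (@not_sub_points j i _).
  by case/(tau_line_eq0 (PL j)) => b ->; rewrite scalemx_sub.
by rewrite eq_sym.
Qed.

(** The vector v can be moved along P_i, inside T_i and without changing F, until
    it lies in T_j as well; it then differs from w by a multiple of P_j. *)
Lemma eq_value_tangents i j v w :
  tau i v = 0 -> tau j w = 0 -> (v - w <= L)%MS -> F.@[v 0] = F.@[w 0].
Proof.
move=> tv tw vwL.
have [ij|ij] := eqVneq i j.
  by subst j; apply: (eq_value_same_tangent tv).
pose s := - tau j v / tau j (P i).
rewrite -(tau_shift s tv); apply: eq_value_same_tangent tw _.
  rewrite pairingDr pairingZr divfK ?subrr // tau_neq0 1?eq_sym //.
by rewrite addrAC addmx_sub // scalemx_sub.
Qed.

(** The form on the quotient by L whose pullback agrees with F on every T_i: v is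
    moved into T_0 along u.  Its independence of the index is
    [quotient_form_tangent]. *)
Definition quotient_form v : C := F.@[(v - tau i0 v *: u) 0].

Lemma quotient_form_tangent i v : F.@[(v - tau i v *: u) 0] = quotient_form v.
Proof.
apply: (@eq_value_tangents i i0).
- by rewrite pairingBr pairingZr tau_u mulr1 subrr.
- by rewrite pairingBr pairingZr tau_u mulr1 subrr.
- have -> : v - tau i v *: u - (v - tau i0 v *: u) = (tau i0 v - tau i v) *: u.
    by apply/rowP => j; rewrite !mxE; ring.
  by rewrite scalemx_sub.
Qed.

Lemma quotient_form_shift v x : (x <= L)%MS -> quotient_form (v + x) = quotient_form v.
Proof.
move=> xL; apply: (@eq_value_tangents i0 i0).
- by rewrite pairingBr pairingZr tau_u mulr1 subrr.
- by rewrite pairingBr pairingZr tau_u mulr1 subrr.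
- have -> : v + x - tau i0 (v + x) *: u - (v - tau i0 v *: u) 
          = x - (tau i0 (v + x) - tau i0 v) *: u.
    by apply/rowP => j; rewrite !mxE; ring.
  by rewrite addmx_sub // eqmx_opp scalemx_sub.
Qed.

Lemma quotient_form_scale a v : quotient_form (a *: v) = a ^+ k.+1 * quotient_form v.
Proof. by rewrite /quotient_form pairingZr -scalerA -scalerBr (meval_scale homF). Qed.

(** F(v + t u) has leading coefficient F(u) and next coefficient dF_u(v); since
    the - tau_i(v) are k of the roots of F(v + t u) - F0(v), the remaining root
    is - mu(v) / F(u), with mu the following form. *)
Definition cofactor_form : 'rV[C]_n :=
  gradient F u - F.@[u 0] *: \sum_i tau_form i.
Notation mu v := (pairing cofactor_form v).

Lemma muE v : mu v = pairing (gradient F u) v - F.@[u 0] * \sum_i tau i v.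
Proof. by rewrite pairingBl pairingZl pairing_suml. Qed.

Lemma normal_form_generic v : injective (fun i => tau i v) ->
  F.@[v 0] = quotient_form v + mu v * \prod_i tau i v.
Proof.
move=> tI; pose p := pencil F v u - (quotient_form v)%:P.
have k0 : (0 < k)%N by exact: ltnW.
have sp : (size p <= k.+2)%N.
  apply: (leq_trans (size_polyD _ _)); rewrite geq_max (size_pencil homF).
  by rewrite size_polyN (leq_trans (size_polyC_leq1 _)).
have rI : injective (fun i => - tau i v) by move=> i j /oppr_inj/tI.
have rp i : p.[- tau i v] = 0.
  by rewrite hornerD hornerN hornerC horner_pencil scaleNr quotient_form_tangent subrr.
have pk1 : p`_k.+1 = F.@[u 0].
  by rewrite coefB coefC /= subr0 (coef_pencil_lead homF).
have pk : p`_k = pairing (gradient F u) v.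
  rewrite coefB coefC (gtn_eqF k0) subr0.
  by have := coef_pencil_sublead homF v u isT.
have := congr1 (fun q => q.[0]) (split_off_roots k0 sp rI rp).
rewrite hornerM horner_prod !hornerE horner_pencil scale0r addr0 pk pk1.
under eq_bigr do rewrite !hornerE opprK.
rewrite sumrN mulrN -muE => /eqP.
by rewrite subr_eq addrC => /eqP.
Qed.

(** tau_i and tau_j agree at u; if they also agreed at P_0 they would agree on
    all of L, although only one of them vanishes at P_i. *)
Lemma tau_diff_neq0 i j :
  i != j -> pairing (tau_form i - tau_form j) (P i0) != 0.
Proof.
move=> ij; have uP : ~~ (u <= P i0)%MS.
  by apply: contraNN Fu => /sub_rVP[a ->]; rewrite (meval_scale homF) FP mulr0.
have [a [b EP]] := line_span rankL (P_neq0 i0) uP uL (PL i0) (PL i).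
have tj : tau j (P i) != 0 by rewrite tau_neq0 // eq_sym.
apply: contraNneq tj => d0.
have : pairing (tau_form i - tau_form j) (P i) = 0.
  by rewrite EP pairingDr !pairingZr d0 pairingBl !tau_u subrr !mulr0 addr0.
by rewrite pairingBl tauP sub0r => /eqP; rewrite oppr_eq0.
Qed.

(** The values tau_i(v) need not be distinct.  They become so for almost all
    points v + s P_0, where both sides are polynomials in s. *)
Lemma normal_form (v : 'rV[C]_n) : F.@[v 0] = quotient_form v + mu v * \prod_i tau i v.
Proof.
pose x := P i0.
pose lin (g : 'rV[C]_n) : {poly C} := (pairing g v)%:P + pairing g x *: 'X.
have linE g s : (lin g).[s] = pairing g (v + s *: x).
  by rewrite pairingDr pairingZr !hornerE mulrC.
(* b vanishes at s exactly when two of the tau_i (v + s x) coincide. *)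
pose b := \prod_i \prod_(j | j != i) lin (tau_form i - tau_form j).
have b0 : b != 0.
  apply/prodf_neq0 => i _; apply/prodf_neq0 => j ji.
  apply: contraNneq (tau_diff_neq0 (i := i) (j := j) _) => [l0|].
    have := congr1 (fun q : {poly C} => q`_1) l0.
    by rewrite coefD coefC coefZ coefX mulr1 add0r coef0 => ->.
  by rewrite eq_sym.
suff E : pencil F v x = (quotient_form v)%:P
              + lin cofactor_form * \prod_i lin (tau_form i).
  have := congr1 (fun q => q.[0]) E.
  rewrite horner_pencil hornerD hornerM hornerC linE horner_prod scale0r addr0.
  by under eq_bigr do rewrite linE scale0r addr0.
apply: (poly_eq_off_roots b0) => s bs.
rewrite horner_pencil hornerD hornerM hornerC horner_prod linE.
under eq_bigr do rewrite linE.
have xL : (s *: x <= L)%MS by apply/scalemx_sub/PL.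
rewrite -(quotient_form_shift v xL); apply: normal_form_generic.
move=> i j tij; apply/eqP; apply: contraNT bs => ij.
rewrite horner_prod (bigD1 i) //= horner_prod (bigD1 j) 1?eq_sym //=.
by rewrite linE pairingBl tij subrr !mul0r.
Qed.

Lemma quotient_form_line x : (x <= L)%MS -> quotient_form x = 0.
Proof.
move=> xL; rewrite -[x]add0r quotient_form_shift //.
by rewrite /quotient_form pairing0r scale0r subr0 (meval_form0 homF).
Qed.

Lemma line_form x : (x <= L)%MS -> F.@[x 0] = mu x * \prod_i tau i x.
Proof. by move=> xL; rewrite normal_form quotient_form_line // add0r. Qed.

Lemma mu_u : mu u = F.@[u 0].
Proof.
by rewrite line_form // big1 ?mulr1 // => i _; rewrite tau_u.
Qed.

(** The zero of mu on L, found on the line through P_0 in the direction of u. *)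
Definition last_point : 'rV[C]_n := P i0 - (mu (P i0) / F.@[u 0]) *: u.

Lemma last_point_line : (last_point <= L)%MS.
Proof. by rewrite addmx_sub // eqmx_opp scalemx_sub. Qed.

Lemma last_point_neq0 : last_point != 0.
Proof.
rewrite subr_eq0; set c := _ / _; apply: contraNneq (P_neq0 i0) => E.
have := FP i0; rewrite E (meval_scale homF) => /eqP.
rewrite mulf_eq0 (negbTE Fu) orbF expf_eq0 /= => /eqP ->.
by rewrite scale0r.
Qed.

Lemma mu_last_point : mu last_point = 0.
Proof. by rewrite pairingBr pairingZr mu_u divfK // subrr. Qed.

Lemma mu_line_eq0 x : (x <= L)%MS -> mu x = 0 -> exists b, x = b *: last_point.
Proof.
move=> xL mx.
apply: (zero_on_line rankL _ last_point_neq0 mu_last_point mx uL _ xL).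
  by rewrite mu_u.
exact: last_point_line.
Qed.

(** If mu vanished at P_i, then F restricted to L would vanish doubly at P_i, but
    its derivative there in the direction u is nonzero. *)
Lemma mu_P_neq0 i : mu (P i) != 0.
Proof.
apply: contraNneq (tangent_form_u_neq0 i) => mP.
pose q := \prod_(j | j != i) ((tau j (P i))%:P + 'X).
suff E : pencil F (P i) u = F.@[u 0] *: ('X * ('X * q)).
  by rewrite -coef1_pencil E coefZ !coefXM /= mulr0.
apply: poly_eq_horner => s; rewrite horner_pencil line_form; last first.
  by rewrite addmx_sub // scalemx_sub.
rewrite pairingDr pairingZr mP add0r mu_u (bigD1 i) //=.
rewrite pairingDr pairingZr tauP add0r tau_u mulr1.
rewrite hornerZ !hornerM hornerX horner_prod mulrA [s * _]mulrC -!mulrA.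
congr (_ * (_ * (_ * _))); apply: eq_bigr => j _.
by rewrite pairingDr pairingZr tau_u mulr1 !hornerE.
Qed.

Lemma tau_last_point_neq0 i : tau i last_point != 0.
Proof.
apply: contraNneq last_point_neq0 => tL.
have [b E] := tau_line_eq0 last_point_line tL.
have := mu_last_point; rewrite E pairingZr => /eqP.
by rewrite mulf_eq0 (negbTE (mu_P_neq0 i)) orbF => /eqP->; rewrite scale0r.
Qed.

(** Along P_d + s w, the contribution of F0 is s^d F0(w), of order at least 2, and
    mu contributes the factor s mu(w), so the linear term is that of the
    product. *)
Lemma gradient_last_point w :
  pairing (gradient F last_point) w = mu w * \prod_i tau i last_point.
Proof.
pose q := \prod_i ((tau i last_point)%:P + tau i w *: 'X).
suff E : pencil F last_point w = quotient_form w *: 'X^(k.+1) + mu w *: ('X * q).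
  rewrite -coef1_pencil E coefD !coefZ coefXn coefXM /= -horner_coef0.
  rewrite eqSS eq_sym gtn_eqF ?(ltnW k_gt1) // mulr0 add0r horner_prod.
  by congr (_ * _); apply: eq_bigr => i _; rewrite !hornerE.
apply: poly_eq_horner => s; rewrite horner_pencil normal_form.
rewrite [last_point + _]addrC quotient_form_shift ?last_point_line // quotient_form_scale.
rewrite hornerD !hornerZ hornerM hornerXn hornerX horner_prod.
rewrite pairingDr pairingZr mu_last_point addr0 [_ ^+ _ * _]mulrC.
rewrite [s * mu w]mulrC -mulrA; congr (_ + _ * (_ * _)); apply: eq_bigr => i _.
by rewrite pairingDr pairingZr addrC !hornerE [s * _]mulrC.
Qed.

Lemma prod_tau_last_point_neq0 : \prod_i tau i last_point != 0.
Proof. by apply/prodf_neq0 => i _; exact: tau_last_point_neq0. Qed.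

(** On mu = 0 the form F is the pullback of F0, which is constant along L; and
    this pullback is nonzero there because F is nonzero on T_0 and both
    hyperplanes surject onto the quotient by L. *)
Lemma cone_last_point : cone_point F last_point.
Proof.
have mu0 v : pairing (gradient F last_point) v = 0 <-> mu v = 0.
  rewrite gradient_last_point; split=> [/eqP|->]; last by rewrite mul0r.
  by rewrite mulf_eq0 (negbTE prod_tau_last_point_neq0) orbF => /eqP.
split.
- exact/mu0/mu_last_point.
- move=> v s /mu0 mv; rewrite !normal_form pairingDr pairingZr mv.
  rewrite mu_last_point mulr0 addr0 !mul0r quotient_form_shift //.
  by rewrite scalemx_sub // last_point_line.
- have [_ _ [v [/eqP gv Fv]]] := coneP i0.
  move: gv; rewrite -tau_eq0 => /eqP tv.
  have mw : mu (v - (mu v / F.@[u 0]) *: u) = 0.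
    by rewrite pairingBr pairingZr mu_u divfK // subrr.
  exists (v - (mu v / F.@[u 0]) *: u); split; first exact/mu0.
  rewrite normal_form mw mul0r addr0 quotient_form_shift.
    by rewrite /quotient_form tv scale0r subr0.
  by rewrite eqmx_opp scalemx_sub.
Qed.

Lemma transversal_at_form (x : 'rV[C]_n) : pairing (gradient F x) u != 0 ->
  transversal_at F L x.
Proof.
move=> gu; split.
  by apply: contraNneq gu => g0; rewrite g0 pairing0l.
apply: contraNN gu => /(submx_trans uL).
by rewrite tangent_hyperplaneP.
Qed.

Lemma line_zeros (x : 'rV[C]_n) : x != 0 -> (x <= L)%MS -> F.@[x 0] = 0 ->
  (x == last_point)%MS \/ exists i, (x == P i)%MS.
Proof.
move=> x0 xL /eqP; rewrite line_form // mulf_eq0 => /orP[/eqP mx|].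
  left; have [b E] := mu_line_eq0 xL mx.
  by apply: proportional_points; rewrite // E scalemx_sub.
rewrite prodf_seq_eq0 => /hasP[i _ /= /eqP tx]; right; exists i.
have [b E] := tau_line_eq0 xL tx.
by apply: proportional_points; rewrite // E scalemx_sub.
Qed.

End NormalForm.

Lemma last_star_point_exists : exists Q : 'rV[C]_n,
  [/\ [/\ Q != 0, (Q <= L)%MS & F.@[Q 0] = 0],
      forall i, ~~ (P i == Q)%MS,
      cone_point F Q,
      forall x : 'rV[C]_n, x != 0 -> (x <= L)%MS -> F.@[x 0] = 0 ->
        (x == Q)%MS \/ exists i, (x == P i)%MS
    & transversal_at F L Q /\ forall i, transversal_at F L (P i)].
Proof.
have [u [uL Fu]] := line_nonzero_value.
exists (@last_point u); split.
- split; [exact: last_point_neq0 | exact: last_point_line |].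
  by rewrite (line_form uL Fu) ?last_point_line // mu_last_point // mul0r.
- move=> i; apply: contraNN (tau_last_point_neq0 uL Fu i) => /andP[_].
  by case/sub_rVP=> b ->; rewrite pairingZr (tauP uL Fu) mulr0.
- exact: cone_last_point.
- exact: line_zeros.
- split=> [|i]; apply: (transversal_at_form uL).
    rewrite gradient_last_point // mulf_neq0 ?prod_tau_last_point_neq0 //.
    by rewrite (mu_u uL Fu).
  exact: tangent_form_u_neq0.
Qed.

End StarPointsOnLine.

Theorem theorem3p4 (R : realType) (N d : nat) (F : {mpoly R[i][N.+1]})
    (L : 'M[R[i]]_(2, N.+1)) (P : 'I_d.-1 -> 'rV[R[i]]_N.+1)
    (hN : (3 <= N)%N) (hd : (3 <= d)%N)
    (hX : is_hypersurface d F) (smoothX : smooth_hyp F)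
    (hL : is_line L) (LX : ~ sub_hyp F L)
    (starP : forall i : 'I_d.-1, star_point d F (P i))
    (PL : forall i : 'I_d.-1, (P i <= L)%MS)
    (distP : distinct_points P) :
  exists Q : 'I_d -> 'rV[R[i]]_N.+1,
    [/\ forall i : 'I_d.-1, Q (widen_ord (leq_pred d) i) = P i,
        meets_transversally_at F L Q
      & forall i : 'I_d, i = d.-1 :> nat -> star_point d F (Q i)].
Proof.
case: d => [|k] // in P hd hX starP PL distP *.
have [_ homF] := hX.
have P0 i : P i != 0 by have [] := starP i.
have FP i : F.@[P i 0] = 0 by have [] := starP i.
have coneP i : cone_point F (P i).
  by have /(star_pointP homF)[] := starP i.
have [Pd [[Pd0 PdL FPd] PPd conePd zeros [trPd trP]]] :=
  last_star_point_exists homF hd hL LX PL P0 FP coneP distP.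
pose Q (j : 'I_k.+1) := if insub (j : nat) is Some i then P i else Pd.
have QP (i : 'I_k) : Q (widen_ord (leq_pred k.+1) i) = P i.
  by rewrite /Q /= valK.
have Qd (j : 'I_k.+1) : j = k :> nat -> Q j = Pd.
  by move=> jk; rewrite /Q insubN // jk ltnn.
have QE j : (j = ord_max /\ Q j = Pd) \/
            exists i, j = widen_ord (leq_pred k.+1) i /\ Q j = P i.
  have [jk|jk] := ltnP j k.
    by right; exists (Ordinal jk); rewrite -QP; split; [|congr Q]; apply: val_inj.
  have Ej : j = k :> nat by apply/eqP; rewrite eqn_leq jk -ltnS ltn_ord.
  by left; rewrite Qd //; split=> //; apply: val_inj.
exists Q; split; first exact: QP; last first.
  move=> j /Qd ->; apply/(star_pointP homF).
  by case: trPd.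
split.
- move=> j; case: (QE j) => [[_ ->]|[i [_ ->]]].
    exact: conj Pd0 PdL.
  exact: conj (P0 i) (PL i).
- move=> i j; case: (QE i) => [[-> ->]|[i' [-> ->]]];
    case: (QE j) => [[-> ->]|[j' [-> ->]]].
  + by rewrite eqxx.
  + by rewrite andbC PPd.
  + by rewrite PPd.
  + move=> ij; apply: distP; apply: contraNneq ij => ->; exact: eqxx.
- move=> x x0 xL; split=> [/(zeros x x0 xL)[xQ|[i xP]]|[j]].
  + by exists ord_max; rewrite Qd.
  + by exists (widen_ord (leq_pred k.+1) i); rewrite QP.
  + case: (QE j) => [[_ ->]|[i [_ ->]]] /andP[/sub_rVP[b ->] _];
      by rewrite /on_hyp (meval_scale homF) ?FPd ?FP mulr0.
- move=> j; case: (QE j) => [[_ ->]|[i [_ ->]]]; first exact: trPd.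
  exact: trP.
Qed.
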